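(* Let $L$ be a frame with five or more elements. Suppose that $L$ has exactly two points and that $L$ is a generator in the category of frames. Then the set $\mathrm{Arr}\langle L,L\rangle$ of frame arrows from $L$ to itself has at least four elements.
   Context: A frame (also called a locale, when regarded as an object) is a complete lattice satisfying $a\wedge\bigvee_{i\in I}b_i=\bigvee_{i\in I}(a\wedge b_i)$. The arrows of the category of frames are the functions preserving finite meets (including the top element $1$) and arbitrary joins (including the bottom element $0$). $\mathrm{Arr}\langle A,B\rangle$ denotes the set of arrows of the category of frames with source $A$ and target $B$. Let $T=\{0,1\}$ be the two-element frame; a point of a frame $L$ is a frame arrow $L\to T$. An object $G$ of a category is a generator if for any two unequal arrows $f,g:A\to B$ there is an arrow $n:G\to A$ with $f\circ n\neq g\circ n$. *)

(* Defs.v *)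
From HB Require Import structures.
From mathcomp Require Import all_boot all_order.
From mathcomp Require Import boolp classical_sets functions cardinality.

Set Implicit Arguments.
Unset Strict Implicit.
Unset Printing Implicit Defensive.

Import Order.LTheory.

Local Open Scope classical_set_scope.
Local Open Scope order_scope.

(* Joins of arbitrary families are joins of their ranges, so [Join] is indexed
   by subsets.  The trivial frame, with [\bot = \top], is allowed. *)
HB.mixin Record TBLattice_isFrame (d : Order.disp_t) (L : Type)
    of Order.TBLattice d L := {
  Join : set L -> L;
  Join_isLub : forall S : set L, isLub S (Join S);
  meet_Join : forall (a : L) (S : set L),
    a `&` Join S = Join [set a `&` b | b in S]
}.

#[short(type="frameType")]
HB.structure Definition Frame (d : Order.disp_t) :=
  { L of TBLattice_isFrame d L & Order.TBLattice d L }.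

(* The case [S = set0] of the last clause is preservation of [\bot]. *)
Definition frame_arrow (d1 d2 : Order.disp_t) (A : frameType d1)
    (B : frameType d2) (f : A -> B) : Prop :=
  [/\ f \top = \top,
      forall x y : A, f (x `&` y) = f x `&` f y
    & forall S : set A, f (Join S) = Join (f @` S)].

Definition Arr (d1 d2 : Order.disp_t) (A : frameType d1) (B : frameType d2) :
  set (A -> B) := [set f | frame_arrow f].
Arguments Arr {d1 d2} A B _.

Definition bool_Join (S : set bool) : bool := `[< S true >].

Lemma bool_Join_isLub (S : set bool) : isLub S (bool_Join S).
Proof.
rewrite /bool_Join; split=> [[] // Sx|b ub_b]; first by rewrite asboolT.
by case: asboolP => [/ub_b|_] //; case: (b).
Qed.

Lemma bool_meet_Join (a : bool) (S : set bool) :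
  a `&` bool_Join S = bool_Join [set a `&` b | b in S].
Proof.
rewrite /bool_Join andEbool; case: a => /=.
  by congr asbool; apply/propext; split=> [St|[[] ]//]; exists true.
by apply/esym/asboolPn => -[].
Qed.

HB.instance Definition _ :=
  TBLattice_isFrame.Build _ bool bool_Join_isLub bool_meet_Join.

Definition points (d : Order.disp_t) (L : frameType d) : set (L -> bool) :=
  Arr L bool.
Arguments points {d} L _.

Definition generator (d : Order.disp_t) (G : frameType d) : Prop :=
  forall (d1 d2 : Order.disp_t) (A : frameType d1) (B : frameType d2)
    (f g : A -> B),
    Arr A B f -> Arr A B g -> f <> g ->
    exists2 n : G -> A, Arr G A n & f \o n <> g \o n.

(* Main.v *)
From HB Require Import structures.
Require Import Defs.
From mathcomp Require Import all_boot all_order.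
From mathcomp Require Import boolp classical_sets functions cardinality.

(** The three-element chain [\bot < middle < \top] is the free frame on the
    generator [middle]: for every element [u] of a frame [B], sending [middle]
    to [u] defines a frame arrow from the chain to [B] ([Sierpinski_arrow]).
    In particular the chain has two points, which differ at [middle] only; as
    the generator [L] must separate them, there is an arrow [n] from [L] to the
    chain which takes the value [middle] ([generator_middle]).  Composing [n]
    with the arrows from the chain to [L] then embeds [L] into the set of its
    own endomorphisms, because the composite given by [u] takes the value [u]
    wherever [n] takes the value [middle].  Hence [Arr L L] has at least as
    many elements as [L] ([generator_card_le_Arr]), so at least five. *)

Import Order.TTheory.

Local Open Scope classical_set_scope.
Local Open Scope order_scope.
Local Open Scope card_scope.

Lemma isLub_Join_eq {d : Order.disp_t} {L : frameType d} (S : set L) (m : L) :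
  isLub S m -> Join S = m.
Proof.
move=> [ub_m least_m]; have [ub_J least_J] := Join_isLub S.
by apply/le_anti; rewrite least_J ?least_m.
Qed.

Lemma comp_frame_arrow {d1 d2 d3 : Order.disp_t} {A : frameType d1}
    {B : frameType d2} {C : frameType d3} (g : B -> C) (f : A -> B) :
  Arr B C g -> Arr A B f -> Arr A C (g \o f).
Proof.
move=> [g1 gI gJ] [f1 fI fJ]; split=> [|x y|S] /=; first by rewrite f1.
  by rewrite fI gI.
by rewrite fJ gJ image_comp.
Qed.

(** A separate name for ['I_n.+1], so that its total order and its two bounds
    are combined into a single bounded lattice structure. *)
Definition chain (n : nat) : Type := 'I_n.+1.

HB.instance Definition _ n := Finite.on (chain n).
HB.instance Definition _ n := Order.Total.copy (chain n) 'I_n.+1.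
HB.instance Definition _ n :=
  @Order.hasBottom.Build _ (chain n) ord0 (@leq0n).
HB.instance Definition _ n :=
  @Order.hasTop.Build _ (chain n) ord_max (@leq_ord n).

Section FiniteChain.
Variable n : nat.

Definition chain_Join (S : set (chain n)) : chain n := \join_(i | `[< S i >]) i.

Lemma chain_Join_isLub (S : set (chain n)) : isLub S (chain_Join S).
Proof.
split=> [i Si|b ub_b]; last by apply/joinsP => i /asboolP/ub_b.
by apply: (joins_sup id); apply/asboolP.
Qed.

(** Of two elements of a chain, the larger is their join, so a finite join in a
    chain never leaves the family, unless the family is empty. *)
Lemma chain_Join_attained (S : set (chain n)) :
  chain_Join S = \bot \/ S (chain_Join S).
Proof.
rewrite /chain_Join; elim/big_ind: _ => [|i j Si Sj|i /asboolP Si].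
- by left.
- by have [ij|/ltW ji] := leP i j; rewrite ?(join_r ij) ?(join_l ji).
- by right.
Qed.

Lemma chain_meet_Join (a : chain n) (S : set (chain n)) :
  a `&` chain_Join S = chain_Join [set a `&` b | b in S].
Proof.
have [ub_S _] := chain_Join_isLub S.
have [ub_aS least_aS] := chain_Join_isLub [set a `&` b | b in S].
apply/le_anti/andP; split; last first.
  by apply: least_aS => _ [b Sb <-]; apply/leI2/ub_S.
have [->|SJ] := chain_Join_attained S; first by rewrite meetx0 le0x.
by apply: ub_aS; exists (chain_Join S).
Qed.

HB.instance Definition _ :=
  TBLattice_isFrame.Build _ (chain n) chain_Join_isLub chain_meet_Join.

(** A join in a finite chain being [\bot] or attained, the image of its
    attained value bounds the image of the family; binary meets are likewise
    one of their two arguments. *)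
Lemma monotone_frame_arrow {d : Order.disp_t} {B : frameType d}
    (f : chain n -> B) :
  {homo f : i j / i <= j} -> f \bot = \bot -> f \top = \top ->
  Arr (chain n) B f.
Proof.
move=> f_homo f0 f1; split=> // [i j|S].
  have [ij|/ltW ji] := leP i j.
    by apply/esym/meet_idPl/f_homo.
  by apply/esym/meet_idPr/f_homo.
apply/esym/isLub_Join_eq; have [ub_J _] := Join_isLub S.
split=> [_ [i Si <-]|b ub_b]; first exact/f_homo/ub_J.
have [->|SJ] : Join S = \bot \/ S (Join S) := chain_Join_attained S.
  by rewrite f0 le0x.
by apply: ub_b; exists (Join S).
Qed.

End FiniteChain.

Definition middle : chain 2 := inord 1.

(** With [B := bool] these are the two points of the chain; the name recalls
    that the chain is the frame of open sets of the Sierpinski space. *)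
Definition Sierpinski_map {d : Order.disp_t} {B : frameType d} (u : B)
    (i : chain 2) : B :=
  if i == \bot then \bot else if i == \top then \top else u.

Lemma Sierpinski_map_middle {d : Order.disp_t} {B : frameType d} (u : B) :
  Sierpinski_map u middle = u.
Proof. by rewrite /Sierpinski_map -!val_eqE /= inordK. Qed.

Lemma Sierpinski_arrow {d : Order.disp_t} {B : frameType d} (u : B) :
  Arr (chain 2) B (Sierpinski_map u).
Proof.
apply: monotone_frame_arrow => //.
by case=> [[|[|[|//]]] ?] [[|[|[|//]]] ?] //=;
  rewrite /Sierpinski_map -!val_eqE /= ?le0x ?lex1.
Qed.

(** The two points of the chain agree on [\bot] and [\top], so an arrow that
    separates them cannot avoid [middle]. *)
Lemma generator_middle {d : Order.disp_t} {L : frameType d} :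
  generator L ->
  exists2 n : L -> chain 2, Arr L (chain 2) n & exists x, n x = middle.
Proof.
move=> L_gen.
have neq : Sierpinski_map false <> Sierpinski_map true.
  by move/(congr1 (@^~ middle)); rewrite !Sierpinski_map_middle.
have [n n_arr neq_n] :=
  L_gen _ _ _ _ _ _ (Sierpinski_arrow false) (Sierpinski_arrow true) neq.
exists n => //; apply: contrapT => no_x; apply: neq_n; apply/funext => x /=.
rewrite /Sierpinski_map; case: ifP => // n0; case: ifP => // n1.
case: no_x; exists x; apply/val_inj; rewrite /= inordK //.
by move: n0 n1; rewrite -!val_eqE /=; case: (n x) => -[|[|[|]]].
Qed.

(** An endomorphism of the form [Sierpinski_map u \o n] determines [u]: it is
    the value at any [x] with [n x = middle]. *)
Lemma generator_card_le_Arr {d : Order.disp_t} {L : frameType d} :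
  generator L -> [set: L] #<= Arr L L.
Proof.
move=> /generator_middle[n n_arr [x nx]].
pose F (u : L) : L -> L := Sierpinski_map u \o n.
have F_inj : {in [set: L] &, injective F}.
  by move=> u v _ _ /(congr1 (@^~ x)); rewrite /F /= nx !Sierpinski_map_middle.
rewrite -(card_le_eql (inj_card_eq F_inj)); apply: subset_card_le => _ [u _ <-].
exact: comp_frame_arrow (Sierpinski_arrow u) n_arr.
Qed.

Theorem theorem5p1 (d : Order.disp_t) (L : frameType d)
    (L_ge5 : [set: L] #>= `I_5)
    (L_points : points L #= `I_2)
    (L_generator : generator L) :
  Arr L L #>= `I_4.
Proof.
apply: card_le_trans (generator_card_le_Arr L_generator).
by apply: card_le_trans L_ge5; rewrite card_le_II.
Qed.
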